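(* Let $f,m,N,\varpi,a_0,a_\phi$ be smooth functions of $R=r^2$, positive in the case of $f,m,N$, defined for all large $R$, and suppose that as $R\to\infty$ $$f=1+O(R^{-1}),\quad m=R+O(R^0),\quad a_\phi=O(R^{-1/2}),\quad N=R^2+O(R),\quad \varpi=O(R^{-3/2}),\quad a_0=O(R^{-1}).$$ Let $g,A$ be the metric and potential built from these functions as in the context. For either choice of sign, define coordinates $(u_\pm,r,\theta,\phi_\pm,\psi_\pm)$ by $$du_\pm=dt\pm\sqrt{\frac mN}\,\frac{dR}{2f},\qquad d\phi_\pm=d\phi\pm\varpi\sqrt{\frac mN}\,\frac{dR}{2f},\qquad d\psi_\pm=d\psi\pm\varpi\sqrt{\frac mN}\,\frac{dR}{2f}.$$ Then in these coordinates the metric and, after a gauge transformation $A\mapsto A-d\alpha$ with $\alpha=\alpha(r)$, the vector potential are in asymptotically flat Bondi form with regular null infinity and without radiation: $$g_{\mu\nu}=\begin{pmatrix}-1&\pm1&0&0&0\\ \pm1&0&0&0&0\\0&0&r^2&0&0\\0&0&0&r^2\sin^2\theta&0\\0&0&0&0&r^2\cos^2\theta\end{pmatrix}+\begin{pmatrix}O(r^{-2})&O(r^{-2})&O(r^{-1})&O(r^{-1})&O(r^{-1})\\O(r^{-2})&0&0&0&0\\O(r^{-1})&0&O(r^0)&O(r^0)&O(r^0)\\O(r^{-1})&0&O(r^0)&O(r^0)&O(r^0)\\O(r^{-1})&0&O(r^0)&O(r^0)&O(r^0)\end{pmatrix}$$ and $$A_\mu=\begin{pmatrix}O(r^{-2})&0&O(r^{-1})&O(r^{-1})&O(r^{-1})\end{pmatrix},$$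 where the entries displayed as $0$ in the correction matrix and in $A_\mu$ are exactly zero.
   Context: The ansatz, in coordinates $(t,R,\theta,\phi,\psi)$ with $R=r^2$, $0<\theta<\pi/2$, is $$ds^2=-f\,dt^2+\frac{m}{f}\Big(\frac{dR^2}{4N}+d\theta^2\Big)+\frac{N}{m}\Big[\sin^2\theta\,(d\phi-\varpi\,dt)^2+\cos^2\theta\,(d\psi-\varpi\,dt)^2\Big]+\frac{m^2-fN}{m f}\sin^2\theta\cos^2\theta\,(d\phi-d\psi)^2,$$ $$A=a_0\,dt+a_\phi(\sin^2\theta\,d\phi+\cos^2\theta\,d\psi).$$ The upper and lower signs correspond to the two null infinities (past/future). In this notion of Bondi form, the condition that the angular block of $g_{\mu\nu}$ has determinant exactly $r^6\sin^2\theta\cos^2\theta$ is only required in the limit $r\to\infty$. *)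

(* Defs.v *)
From HB Require Import structures.
From mathcomp Require Import all_boot all_order all_algebra.
From mathcomp Require Import all_classical all_reals all_analysis.

Set Implicit Arguments.
Unset Strict Implicit.
Unset Printing Implicit Defensive.

Import Order.TTheory GRing.Theory Num.Theory.
Import numFieldNormedType.Exports.

Local Open Scope classical_set_scope.
Local Open Scope ring_scope.

(* Points of spacetime are row vectors in 'rV_5.  The original coordinates are
   (t, R, theta, phi, psi), with R = r ^ 2; the new ones are
   (u, r, theta, phi', psi'), stored in the same slots.  The angles phi and psi
   are lifted to real numbers; every object below is independent of them. *)
Definition i0 : 'I_5 := @Ordinal 5 0 isT.
Definition i1 : 'I_5 := @Ordinal 5 1 isT.
Definition i2 : 'I_5 := @Ordinal 5 2 isT.
Definition i3 : 'I_5 := @Ordinal 5 3 isT.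
Definition i4 : 'I_5 := @Ordinal 5 4 isT.

(* Declared so that the library's f =O_+oo g typechecks. *)
Canonical pinfty_filter_on (R : realType) :=
  FilterType (pinfty_nbhs R) (@proper_pinfty_nbhs R).

Definition smooth_above {R : realType} (c : R) (f : R -> R) : Prop :=
  forall (n : nat) (x : R), c < x -> derivable (derive1n n f) x 1.

Section Ansatz.
Context {R : realType}.
Implicit Types (f m N w : R -> R) (x v : 'rV[R]_5).

Definition dom (R0 : R) : set 'rV[R]_5 :=
  [set x | R0 < x ord0 i1 /\ 0 < x ord0 i2 < pi / 2].

(* The symmetric bilinear form (polarization) of the line element ds^2 at the
   point x, evaluated at the tangent vectors v1 and v2.  The coordinate one-forms
   dt, dR, ... act on a tangent vector by reading off its entries. *)
Definition metric f m N w x v1 v2 : R :=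
  let rho := x ord0 i1 in
  let th := x ord0 i2 in
  let sq (omega : 'rV[R]_5 -> R) := omega v1 * omega v2 in
  let dt v := v ord0 i0 in
  let dR v := v ord0 i1 in
  let dth v := v ord0 i2 in
  let dphi v := v ord0 i3 in
  let dpsi v := v ord0 i4 in
  - f rho * sq dt
  + m rho / f rho * (sq dR / (4 * N rho) + sq dth)
  + N rho / m rho *
      (sin th ^+ 2 * sq (fun v => dphi v - w rho * dt v)
       + cos th ^+ 2 * sq (fun v => dpsi v - w rho * dt v))
  + (m rho ^+ 2 - f rho * N rho) / (m rho * f rho)
      * sin th ^+ 2 * cos th ^+ 2 * sq (fun v => dphi v - dpsi v).

Definition potential (a0 aphi : R -> R) x v : R :=
  let rho := x ord0 i1 in
  let th := x ord0 i2 in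
  a0 rho * v ord0 i0
  + aphi rho * (sin th ^+ 2 * v ord0 i3 + cos th ^+ 2 * v ord0 i4).

(* X maps the original coordinates to (u, r, theta, phi', psi'), where u, phi'
   and psi' are prescribed through their differentials.  The sign is s = 1 or
   s = -1. *)
Definition bondi_coordinates f m N w (R0 s : R) (X : 'rV[R]_5 -> 'rV[R]_5) :=
  forall x, dom R0 x ->
    let rho := x ord0 i1 in
    let h := Num.sqrt (m rho / N rho) / (2 * f rho) in
    [/\ differentiable X x,
        X x ord0 i1 = Num.sqrt rho,
        X x ord0 i2 = x ord0 i2 &
        forall v : 'rV[R]_5,
          [/\ ('d X x v) ord0 i0 = v ord0 i0 + s * h * v ord0 i1,
              ('d X x v) ord0 i3 = v ord0 i3 + s * w rho * h * v ord0 i1 &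
              ('d X x v) ord0 i4 = v ord0 i4 + s * w rho * h * v ord0 i1]].

End Ansatz.

Section Coordinates.
Context {R : realType}.
Implicit Types (X : 'rV[R]_5 -> 'rV[R]_5) (D : set 'rV[R]_5).

Definition is_chart D X : Prop :=
  {in D &, injective X} /\
  forall x, D x -> differentiable X x /\ 'J X x \in unitmx.

(* The coordinate vector field of the i-th coordinate function of X: as
   'd X x v = v *m 'J X x, row i of the inverse of 'J X x is the unique vector e
   such that 'd X x e is the i-th basis vector. *)
Definition coord_vector X (x : 'rV[R]_5) (i : 'I_5) : 'rV[R]_5 :=
  row i (invmx ('J X x)).

Definition metric_components (g : 'rV[R]_5 -> 'rV[R]_5 -> 'rV[R]_5 -> R) X
    (x : 'rV[R]_5) : 'M[R]_5 :=
  \matrix_(i, j) g x (coord_vector X x i) (coord_vector X x j).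

Definition oneform_components (A : 'rV[R]_5 -> 'rV[R]_5 -> R) X
    (x : 'rV[R]_5) : 'rV[R]_5 :=
  \row_i A x (coord_vector X x i).

(* A - d alpha, where alpha is a function of the coordinate r of X only. *)
Definition gauge_transform (A : 'rV[R]_5 -> 'rV[R]_5 -> R) X (alpha : R -> R)
    (x v : 'rV[R]_5) : R :=
  A x v - 'd (fun y : 'rV[R]_5 => alpha (X y ord0 i1)) x v.

(* None: F vanishes identically; Some n: F = O(r ^ - n) as r tends to infinity,
   uniformly in the other coordinates. *)
Definition has_order D (r : 'rV[R]_5 -> R) (o : option nat)
    (F : 'rV[R]_5 -> R) : Prop :=
  match o with
  | None => forall x, D x -> F x = 0
  | Some n => exists C r1 : R,
      forall x, D x -> r1 < r x -> `|F x| <= C * r x ^- n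
  end.

Definition flat_metric (s r th : R) : 'M[R]_5 :=
  \matrix_(i, j) nth 0 (nth [::]
    [:: [:: -1;  s;       0;                     0;                     0];
        [::  s;  0;       0;                     0;                     0];
        [::  0;  0;  r ^+ 2;                     0;                     0];
        [::  0;  0;       0; r ^+ 2 * sin th ^+ 2;                      0];
        [::  0;  0;       0;                     0; r ^+ 2 * cos th ^+ 2]] i) j.

Definition metric_order (i j : 'I_5) : option nat :=
  nth None (nth [::]
    [:: [:: Some 2; Some 2; Some 1; Some 1; Some 1];
        [:: Some 2;   None;   None;   None;   None];
        [:: Some 1;   None; Some 0; Some 0; Some 0];
        [:: Some 1;   None; Some 0; Some 0; Some 0];
        [:: Some 1;   None; Some 0; Some 0; Some 0]] i) j.

Definition potential_order (i : 'I_5) : option nat :=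
  nth None [:: Some 2; None; Some 1; Some 1; Some 1] i.

(* Asymptotically flat Bondi form with regular null infinity and without
   radiation, for the components G of the metric and A of the potential in the
   coordinates X.  The determinant of the angular (theta, phi, psi) block is
   compared with r ^ 6 sin ^ 2 theta cos ^ 2 theta only in the limit. *)
Definition bondi_form D X (s : R) (G : 'rV[R]_5 -> 'M[R]_5)
    (A : 'rV[R]_5 -> 'rV[R]_5) : Prop :=
  let r x := X x ord0 i1 in
  let th x := X x ord0 i2 in
  [/\ forall i j,
        has_order D r (metric_order i j)
          (fun x => G x i j - flat_metric s (r x) (th x) i j),
      forall i, has_order D r (potential_order i) (fun x => A x ord0 i) &
      forall e : R, 0 < e -> exists r1 : R, forall x, D x -> r1 < r x ->
        `|\det (drsubmx (G x : 'M[R]_(2 + 3, 2 + 3)))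
            / (r x ^+ 6 * sin (th x) ^+ 2 * cos (th x) ^+ 2) - 1| < e].

End Coordinates.

(* Main.v *)
Require Import Defs.
From HB Require Import structures.
From mathcomp Require Import all_boot all_order all_algebra.
From mathcomp Require Import all_classical all_reals all_analysis.
From mathcomp Require Import ring lra.

Set Implicit Arguments.
Unset Strict Implicit.
Unset Printing Implicit Defensive.

Import Order.TTheory GRing.Theory Num.Theory.
Import numFieldNormedType.Exports.

Local Open Scope classical_set_scope.
Local Open Scope ring_scope.

(** With h = sqrt (m / N) / (2 f), the coordinate vector of r is
    e = (- 2 s h r, 2 r, 0, - 2 s w h r, - 2 s w h r); it is null and orthogonal
    to the angular directions, and the other coordinate vectors are those of t,
    theta, phi and psi.  All components of g and A in the new frame are thus
    explicit, the vanishing ones vanish identically, and the orders of the others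
    follow from those of the hypotheses.  The determinant of the angular block is
    (m N / f ^ 2) sin ^ 2 theta cos ^ 2 theta.  A(e) depends on r only, so that a
    primitive alpha of it removes the r-component of A. *)

(** * Smooth functions on a ray and their primitives *)

Section Calculus.
Context {R : realType}.
Implicit Types (c x y : R) (f g : R -> R).

(** The recursion peels off the innermost derivative, so that closure properties follow by induction
    on the order with the function generalized. *)
Fixpoint diff_above (n : nat) c f : Prop :=
  if n is k.+1
  then (forall x, c < x -> derivable f x 1) /\ diff_above k c f^`()%classic
  else True.

Lemma smooth_aboveP c f : smooth_above c f <-> forall n, diff_above n c f.
Proof.
split=> [fC n|fC n x cx].
  elim: n f fC => //= n IH f fC; split; first exact: (fC 0%N).
  by apply: IH => k x cx; rewrite -derive1Sn; exact: (fC k.+1).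
elim: n f fC => [|n IH] f fC; first by case: (fC 1%N) => + _; exact.
by rewrite derive1Sn; apply: IH => k; case: (fC k.+1).
Qed.

(** Derivatives are local, and the open ray is a neighbourhood of each of its points. *)
Lemma eq_diff_above n c f g : (forall x, c < x -> f x = g x) ->
  diff_above n c f -> diff_above n c g.
Proof.
elim: n f g => //= n IH f g fg [df Df].
have fg_near x : c < x -> \forall y \near x, f y = g y.
  by move=> /lt_nbhsr; apply: filterS.
split=> [x cx|]; first exact: near_eq_derivable (fg_near _ cx) (df _ cx).
apply: IH Df => x cx; rewrite !derive1E.
exact: near_eq_derive (fg_near _ cx).
Qed.

(** The induction step of every closure property below: it suffices to exhibit a formula for the
    derivative on the ray and to bound the order of that formula. *)
Lemma diff_above_derive n c f df :
  (forall x, c < x -> is_derive x 1 f (df x)) ->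
  diff_above n c df -> diff_above n.+1 c f.
Proof.
move=> fdf Ddf; split=> [x /fdf[]//|].
by apply: eq_diff_above Ddf => x /fdf[_ <-]; rewrite derive1E.
Qed.

Lemma diff_aboveW n c f : diff_above n.+1 c f -> diff_above n c f.
Proof. by elim: n f => //= n IH f [df Df]; split=> //; exact: IH. Qed.

Lemma diff_above_is_derive n c f x : diff_above n.+1 c f -> c < x ->
  is_derive x 1 f (f^`()%classic x).
Proof. by move=> [df _] cx; rewrite derive1E; exact/derivableP/df. Qed.

Lemma diff_above_cst n c (k : R) : diff_above n c (fun=> k).
Proof. by elim: n k => // n IH k; exact: diff_above_derive (IH 0). Qed.

Lemma diff_above_id n c : diff_above n c id.
Proof. by case: n => // n; exact: diff_above_derive (diff_above_cst _ _ 1). Qed.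

Lemma diff_aboveD n c f g : diff_above n c f -> diff_above n c g ->
  diff_above n c (fun x => f x + g x).
Proof.
elim: n f g => // n IH f g Df Dg.
apply: diff_above_derive (IH _ _ Df.2 Dg.2) => x cx.
exact: is_deriveD (diff_above_is_derive Df cx) (diff_above_is_derive Dg cx).
Qed.

Lemma diff_aboveM n c f g : diff_above n c f -> diff_above n c g ->
  diff_above n c (fun x => f x * g x).
Proof.
elim: n f g => // n IH f g Df Dg.
apply: diff_above_derive (diff_aboveD (IH _ _ (diff_aboveW Df) Dg.2)
  (IH _ _ (diff_aboveW Dg) Df.2)) => x cx.
exact: is_deriveM (diff_above_is_derive Df cx) (diff_above_is_derive Dg cx).
Qed.

Lemma diff_aboveZ n c k f : diff_above n c f ->
  diff_above n c (fun x => k * f x).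
Proof. exact/diff_aboveM/diff_above_cst. Qed.

(** The derivative of [1 / f] is again a product of [1 / f] and [f'], so the induction hypothesis
    for [1 / f] itself, one order lower, closes the step. The square root below works in the same
    way. *)
Lemma diff_aboveV n c f : (forall x, c < x -> f x != 0) ->
  diff_above n c f -> diff_above n c (fun x => (f x)^-1).
Proof.
move=> f0; elim: n f f0 => // n IH f f0 Df.
have DV := IH _ f0 (diff_aboveW Df).
apply: (diff_above_derive (df := fun x =>
  -1 * ((f x)^-1 * (f x)^-1 * f^`()%classic x))) => [x cx|]; last first.
  exact/diff_aboveZ/diff_aboveM/Df.2/diff_aboveM.
have ? := diff_above_is_derive Df cx.
apply: is_derive_eq; first exact: is_deriveV (f0 _ cx) _.
by rewrite /GRing.scale/= mulN1r exprSr expr1 invfM mulNr.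
Qed.

Lemma diff_above_sqrt n c f : (forall x, c < x -> 0 < f x) ->
  diff_above n c f -> diff_above n c (fun x => Num.sqrt (f x)).
Proof.
move=> f0; elim: n f f0 => // n IH f f0 Df.
have DS := IH _ f0 (diff_aboveW Df).
apply: (diff_above_derive (df := fun x =>
  (2 * Num.sqrt (f x))^-1 * f^`()%classic x)) => [x cx|].
  apply: is_derive1_comp; first exact/is_derive1_sqrt/f0.
  exact: diff_above_is_derive Df cx.
apply: diff_aboveM Df.2; apply: diff_aboveV; last exact: diff_aboveZ.
by move=> x /f0 fx; rewrite mulf_neq0 ?pnatr_eq0// gt_eqF// sqrtr_gt0.
Qed.

Lemma diff_above_comp n c c' f g : (forall x, c < x -> c' < g x) ->
  diff_above n c' f -> diff_above n c g -> diff_above n c (fun x => f (g x)).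
Proof.
move=> cg; elim: n f => // n IH f Df Dg.
apply: diff_above_derive (diff_aboveM (IH _ Df.2 (diff_aboveW Dg)) Dg.2).
move=> x cx; apply: is_derive1_comp.
  exact: diff_above_is_derive Df (cg _ cx).
exact: diff_above_is_derive Dg cx.
Qed.

Lemma diff_above_continuous n c f x : diff_above n.+1 c f -> c < x ->
  {for x, continuous f}.
Proof.
by move=> [df _] /df dfx; exact/differentiable_continuous/derivable1_diffP.
Qed.

(** Mean value theorem. The case [k = 0] compares primitives; nonzero [k] serves the injectivity of
    the coordinates. *)
Lemma cst_derive_incr (a b k : R) f : a <= b ->
  (forall x, x \in `[a, b]%R -> is_derive x 1 f k) -> f b - f a = k * (b - a).
Proof.
move=> ab fk.
have dk x : x \in `]a, b[%R -> is_derive x 1 f k.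
  by move=> /subset_itv_oo_cc; exact: fk.
have cf : {within `[a, b], continuous f}.
  by apply: derivable_within_continuous => x /fk[].
by have [c _ ->] := MVT_segment ab dk cf.
Qed.

Lemma eq_sub_of_eq_derive c f g df x y :
  (forall z, c < z -> is_derive z 1 f (df z)) ->
  (forall z, c < z -> is_derive z 1 g (df z)) ->
  c < x -> c < y -> f x - f y = g x - g y.
Proof.
move=> fdf gdf; wlog yx : x y / y <= x.
  move=> H cx cy; have [/H|/ltW/H] := leP y x; first exact.
  by move=> /(_ cy cx)/(congr1 -%R); rewrite !opprB.
move=> cx cy.
have := @cst_derive_incr y x 0 (f \- g) yx.
rewrite mul0r /= => H; apply/eqP; rewrite -subr_eq0 -[X in _ == X]H.
  by rewrite !opprB; apply/eqP; ring.
move=> z; rewrite in_itv/= => /andP[yz _]; have cz := lt_le_trans cy yz.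
by rewrite -(subrr (df z)); apply: is_deriveB; [exact: fdf|exact: gdf].
Qed.

(** The primitive is the integral from [a]; integrability is taken up to [x + 1] so that [x] is
    interior, as the fundamental theorem of calculus requires. *)
Lemma primitive_from f c a : (forall x, c < x -> {for x, continuous f}) ->
  c < a -> exists F : R -> R, forall x, a < x -> is_derive x 1 F (f x).
Proof.
move=> fc ca; exists (fun x => \int[lebesgue_measure]_(t in `[a, x]) f t)%R.
move=> x ax; have fi : lebesgue_measure.-integrable `[a, x + 1] (EFin \o f).
  apply: continuous_compact_integrable; first exact: segment_compact.
  apply: continuous_in_subspaceT => y /[!inE]/= /itvP ay.
  by apply: fc; rewrite (lt_le_trans ca) ?ay.
have x1 : x < x + 1 by rewrite ltrDl.
have [//|| dF <-] := continuous_FTC1 x1 fi; first exact/fc/(lt_trans ca).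
by rewrite derive1E; exact: derivableP.
Qed.

(* The primitive on ]a, +oo[ that vanishes at b does not depend on a < b, so
   these primitives glue together as a decreases to c. *)
Lemma primitive_above f c : (forall x, c < x -> {for x, continuous f}) ->
  exists F : R -> R, forall x, c < x -> is_derive x 1 F (f x).
Proof.
move=> fc; have /choice[F Ff] : forall a, exists F : R -> R,
    c < a -> forall x, a < x -> is_derive x 1 F (f x).
  move=> a; have [ca|_] := ltP c a; last by exists id.
  by have [F] := primitive_from fc ca; exists F.
(* The starting point [a x] is the midpoint of [c] and the smaller of [x] and [b], hence lies in the
   ray below both. *)
pose b := c + 1; pose a x := (c + Num.min x b) / 2.
have cb : c < b by rewrite ltrDl.
have aP x : c < x -> [/\ c < a x, a x < x & a x < b].
  by move=> cx; rewrite /a; case: (leP x b) => xb; split; lra.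
exists (fun x => F (a x) x - F (a x) b) => x cx.
have [cax axx axb] := aP x cx.
(* Near [x] the moving starting point [a y] can be frozen at [a x]: both primitives are valid past
   the larger of the two, where [y] and [b] lie. *)
apply: (near_eq_is_derive (f := fun y => F (a x) y - F (a x) b)); last first.
  rewrite -[f x]subr0; exact: is_deriveB (Ff _ cax _ axx) (is_derive_cst _ _ _).
near=> y; have axy : a x < y by near: y; exact: lt_nbhsr.
have cy : c < y by rewrite (lt_trans cax).
have [cay ayy ayb] := aP y cy.
apply: (@eq_sub_of_eq_derive (Num.max (a x) (a y)) _ _ f);
  rewrite ?gt_max ?axy ?ayy ?axb ?ayb//.
- by move=> z; rewrite gt_max => /andP[/(Ff _ cax)].
- by move=> z; rewrite gt_max => /andP[_ /(Ff _ cay)].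
Unshelve. all: by end_near. Qed.

End Calculus.

(** * Differentials in coordinates and Jacobian matrices *)

Section Coord.
Context {R : realType}.
Implicit Types (x v : 'rV[R]_5) (X : 'rV[R]_5 -> 'rV[R]_5).

Lemma forall_ord5 (P : 'I_5 -> Prop) :
  P i0 -> P i1 -> P i2 -> P i3 -> P i4 -> forall i, P i.
Proof.
move=> P0 P1 P2 P3 P4 [[|[|[|[|[|//]]]]] lti].
all: by rewrite (bool_irrelevance lti isT).
Qed.

(** Openness of the domain: it allows differentiating identities that hold only there. *)
Lemma nbhs_dom (R0 : R) x : dom R0 x -> \forall y \near x, dom R0 y.
Proof.
move=> [xR0 /andP[x2 x2pi]].
have near_coord i (P : set R) : nbhs (x ord0 i) P ->
    nbhs x (fun y : 'rV[R]_5 => P (y ord0 i)).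
  exact: (@coord_continuous R 1 5 ord0 i x).
have n1 := near_coord i1 _ (lt_nbhsr xR0).
have n2 := near_coord i2 _ (lt_nbhsr x2).
have n3 := near_coord i2 _ (lt_nbhsl x2pi).
by near=> y; split; [near: y|apply/andP; split; near: y].
Unshelve. all: by end_near. Qed.

Lemma diff_mx_coord m n (V : normedModType R) (M : V -> 'M[R]_(m, n))
    (x v : V) i j :
  differentiable M x -> ('d M x v) i j = 'd (fun y => M y i j) x v.
Proof.
move=> dM; have dMij : differentiable (fun y => M y i j) x.
  have -> : (fun y => M y i j) = (fun N : 'M[R]_(m, n) => N i j) \o M by [].
  by apply: differentiable_comp => //; exact: differentiable_coord.
by rewrite -(deriveE v dMij) -deriveE// derive_mx ?mxE//; exact: diff_derivable.
Qed.

(** Since ['J F x] acts on row vectors from the right, the hypothesis says [E *m 'J F x = 1], and a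
    one-sided inverse of a square matrix is two-sided. *)
Lemma jacobian_inverse n (F : 'rV[R]_n.+1 -> 'rV[R]_n.+1)
    (x : 'rV[R]_n.+1) (E : 'M[R]_n.+1) :
  (forall i, 'd F x (row i E) = delta_mx 0 i) ->
  'J F x \in unitmx /\ invmx ('J F x) = E.
Proof.
move=> FE; have EJ : E *m 'J F x = 1%:M.
  by apply/row_matrixP => i; rewrite row_mul mul_rV_lin1 FE rowE mulmx1.
have [_ Ju] := mulmx1_unit EJ; split=> //.
by rewrite -[LHS]mul1mx -EJ mulmxK.
Qed.

Lemma is_diff_coord m n (M : 'M[R]_(m, n)) i j :
  is_diff M (fun N : 'M[R]_(m, n) => N i j) (fun N => N i j).
Proof.
apply: DiffDef; first exact: differentiable_coord.
apply/funext => v; rewrite -diff_mx_coord ?diff_id//.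
by rewrite diff_val.
Qed.

Lemma is_diff_comp_coord (phi : R -> R) (d : R) x i :
  is_derive (x ord0 i) 1 phi d ->
  is_diff x (fun y : 'rV[R]_5 => phi (y ord0 i)) (fun v => d * v ord0 i).
Proof.
move=> [phid dE].
have phiD : is_diff (x ord0 i) phi (fun h => h *: d).
  have dphi := (derivable1_diffP _ _).1 phid.
  by apply: DiffDef => //; rewrite diff1E// derive1E dE.
have xD := is_diff_coord x ord0 i.
have := is_diff_comp xD phiD.
by move/is_diff_eq; apply; apply/funext => v /=; rewrite [d * _]mulrC.
Qed.

Lemma is_diff_scale_coord (phi : R -> R) (d : R) (c x : 'rV[R]_5) i :
  is_derive (x ord0 i) 1 phi d ->
  is_diff x (fun y => phi (y ord0 i) *: c) (fun v => (d * v ord0 i) *: c).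
Proof.
move=> /is_diff_comp_coord phiD.
exact: is_diff_comp phiD (is_diff_scalel (phi (x ord0 i)) c).
Qed.

Lemma is_derive_line (n : nat) (V : normedModType R) (F : V -> 'rV[R]_n)
    (x v : V) (t : R) i : differentiable F (t *: v + x) ->
  is_derive t 1 (fun t => F (t *: v + x) ord0 i) (('d F (t *: v + x) v) ord0 i).
Proof.
move=> dF; have pD : is_diff t (fun t : R => t *: v + x) (fun h : R => h *: v).
  have := is_diffD (is_diff_scalel t v) (is_diff_cst x t).
  by move/is_diff_eq; apply; rewrite addr0.
have [FD FE] : is_diff t (fun t : R => F (t *: v + x) ord0 i) _ :=
  is_diff_comp (is_diff_comp pD (differentiableP dF))
    (is_diff_coord (F (t *: v + x)) ord0 i).
apply: DeriveDef; first exact: diff_derivable.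
by rewrite deriveE// FE/= scale1r.
Qed.

End Coord.

(** * Bondi coordinates: existence, coordinate frame and injectivity *)

Section Bondi.
Context {R : realType}.
Variables (f m N w : R -> R) (R0 s : R).
Hypothesis R0_ge0 : 0 <= R0.
Let h (rho : R) := Num.sqrt (m rho / N rho) / (2 * f rho).

Section Existence.
Variables H W : R -> R.
Hypothesis H_der : forall rho, R0 < rho -> is_derive rho 1 H (h rho).
Hypothesis W_der : forall rho, R0 < rho -> is_derive rho 1 W (w rho * h rho).

(** This is [u = t + s H], [r = sqrt R], with the same shift [s W] of both angles. It is written as
    a sum of scalar functions times constant vectors so that its differential can be read off
    termwise. *)
Definition bondi_map (x : 'rV[R]_5) : 'rV[R]_5 :=
  x + (Num.sqrt (x ord0 i1) - x ord0 i1) *: delta_mx ord0 i1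
    + H (x ord0 i1) *: (s *: delta_mx ord0 i0)
    + W (x ord0 i1) *: (s *: (delta_mx ord0 i3 + delta_mx ord0 i4)).

Lemma bondi_map_coordinates : bondi_coordinates f m N w R0 s bondi_map.
Proof.
move=> x xD; have [xR0 _] := xD; have x0 := le_lt_trans R0_ge0 xR0.
have dS : is_derive (x ord0 i1) 1 (fun t : R => Num.sqrt t - t)
    ((2 * Num.sqrt (x ord0 i1))^-1 - 1).
  exact: is_deriveB (is_derive1_sqrt x0) (is_derive_id _ _).
have := is_diffD (is_diffD (is_diffD (is_diff_id x)
  (is_diff_scale_coord (delta_mx ord0 i1) dS))
  (is_diff_scale_coord (s *: delta_mx ord0 i0) (H_der xR0)))
  (is_diff_scale_coord (s *: (delta_mx ord0 i3 + delta_mx ord0 i4))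
    (W_der xR0)).
rewrite -[X in is_diff _ X]/bondi_map => -[dX dXE].
split=> //; rewrite ?mxE/=; [ring|ring|].
by move=> v; rewrite dXE !mxE/= /h; split; ring.
Qed.

End Existence.

Variable X : 'rV[R]_5 -> 'rV[R]_5.
Hypothesis X_bondi : bondi_coordinates f m N w R0 s X.
Implicit Types x v : 'rV[R]_5.

(** The differentials of [u] and of the two angles are prescribed; those of [r] and [theta] come
    from differentiating the values of [X] on the open domain. *)
Lemma bondi_diffE x v : dom R0 x ->
  let rho := x ord0 i1 in
  [/\ ('d X x v) ord0 i0 = v ord0 i0 + s * h rho * v ord0 i1,
      ('d X x v) ord0 i1 = (2 * Num.sqrt rho)^-1 * v ord0 i1,
      ('d X x v) ord0 i2 = v ord0 i2,
      ('d X x v) ord0 i3 = v ord0 i3 + s * w rho * h rho * v ord0 i1 &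
      ('d X x v) ord0 i4 = v ord0 i4 + s * w rho * h rho * v ord0 i1].
Proof.
move=> xD; have [dX _ _ /(_ v)[d0 d3 d4]] := X_bondi xD.
have [xR0 _] := xD; have x0 := le_lt_trans R0_ge0 xR0.
have coordE i (g dg : 'rV[R]_5 -> R) :
    (forall y, dom R0 y -> X y ord0 i = g y) ->
    is_diff x g dg -> ('d X x v) ord0 i = dg v.
  move=> gE [dg1 dgE]; rewrite diff_mx_coord// -dgE -deriveE; last first.
    exact: (differentiable_comp (g := fun N : 'rV[R]_5 => N ord0 i) dX
      (differentiable_coord _ _ _)).
  rewrite -deriveE//; apply: near_eq_derive.
  by apply: filterS (nbhs_dom xD) => y; exact: gE.
split=> //.
- apply: (coordE _ (fun y => Num.sqrt (y ord0 i1))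
    (fun v => (2 * Num.sqrt (x ord0 i1))^-1 * v ord0 i1)).
    by move=> y /X_bondi[].
  exact: is_diff_comp_coord (is_derive1_sqrt x0).
- apply: (coordE _ (fun y => y ord0 i2) (fun v => v ord0 i2)).
    by move=> y /X_bondi[].
  exact: is_diff_coord.
Qed.

(** Row [i] is the candidate for the coordinate vector of the [i]-th new coordinate. In row 1,
    [2 * sqrt R] is [dR / dr], and the other entries cancel the contributions of [dR] to [du] and to
    the angular forms. *)
Definition bondi_frame (x : 'rV[R]_5) : 'M[R]_5 :=
  let rho := x ord0 i1 in
  let k := - (2 * s * h rho * Num.sqrt rho) in
  \matrix_(i, j) nth 0 (nth [::]
    [:: [:: 1; 0; 0; 0; 0];
        [:: k; 2 * Num.sqrt rho; 0; w rho * k; w rho * k];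
        [:: 0; 0; 1; 0; 0];
        [:: 0; 0; 0; 1; 0];
        [:: 0; 0; 0; 0; 1]] i) j.

Lemma bondi_frameP x : dom R0 x ->
  'J X x \in unitmx /\ forall i, coord_vector X x i = row i (bondi_frame x).
Proof.
move=> xD; have [xR0 _] := xD; have x0 := le_lt_trans R0_ge0 xR0.
have r0 : Num.sqrt (x ord0 i1) != 0 by rewrite gt_eqF// sqrtr_gt0.
have [|Ju Jinv] := @jacobian_inverse _ _ X x (bondi_frame x).
  move=> i; apply/rowP.
  have [d0 d1 d2 d3 d4] := bondi_diffE (row i (bondi_frame x)) xD.
  by elim/forall_ord5: i d0 d1 d2 d3 d4 => d0 d1 d2 d3 d4; elim/forall_ord5;
    rewrite ?(d0, d1, d2, d3, d4) !mxE/=; field.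
by split=> // i; rewrite /coord_vector Jinv.
Qed.

(** Three coordinates are known only through their differentials, so these are integrated along the
    segment from [x] to [y]. Equal [r] and [theta] keep that segment in the domain. *)
Lemma bondi_injective : {in dom R0 &, injective X}.
Proof.
move=> x y /[!inE] xD yD Xxy.
have [xR0 /andP[x2 x2p]] := xD; have [yR0 _] := yD.
have [_ x1 x2E _] := X_bondi xD; have [_ y1 y2E _] := X_bondi yD.
have x0 := le_lt_trans R0_ge0 xR0; have y0 := le_lt_trans R0_ge0 yR0.
have xy2 : y ord0 i2 = x ord0 i2 by rewrite -y2E -Xxy.
have xy1 : y ord0 i1 = x ord0 i1.
  by apply/esym/eqP; rewrite -eqr_sqrt ?ltW// -x1 -y1 Xxy.
pose v := y - x; pose p (t : R) := t *: v + x.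
have v1 : v ord0 i1 = 0 by rewrite !mxE xy1 subrr.
have v2 : v ord0 i2 = 0 by rewrite !mxE xy2 subrr.
have pD t : dom R0 (p t).
  by split; rewrite !mxE ?xy1 ?xy2 subrr mulr0 add0r ?x2.
(* On the segment from x to y the differential of X along y - x is y - x, since
   the components of y - x along R and theta vanish. *)
have line i : (forall t, ('d X (p t) v) ord0 i = v ord0 i) -> v ord0 i = 0.
  move=> dv; have dp (t : R) : t \in `[0, 1]%R ->
      is_derive t 1 (fun t => X (p t) ord0 i) (v ord0 i).
    by rewrite -(dv t) => _; apply: is_derive_line; have [] := X_bondi (pD t).
  have := cst_derive_incr ler01 dp.
  by rewrite subr0 mulr1 /p scale1r scale0r add0r subrK Xxy subrr => <-.
apply/esym/subr0_eq/rowP => i; rewrite -/v [RHS]mxE; move: i.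
apply: forall_ord5 => //; apply: line => t.
all: have [d0 d1 d2 d3 d4] := bondi_diffE v (pD t).
all: by rewrite ?(d0, d3, d4) v1 mulr0 addr0.
Qed.

End Bondi.

(** * Explicit components of the metric and of the potential *)

Section Components.
Context {R : realType}.
Variables (f m N w a0 aphi : R -> R) (R0 s : R).
Hypothesis R0_ge0 : 0 <= R0.
Hypothesis f_gt0 : forall rho, R0 < rho -> 0 < f rho.
Hypothesis m_gt0 : forall rho, R0 < rho -> 0 < m rho.
Hypothesis N_gt0 : forall rho, R0 < rho -> 0 < N rho.
Hypothesis s2 : s ^+ 2 = 1.
Variable X : 'rV[R]_5 -> 'rV[R]_5.
Hypothesis X_bondi : bondi_coordinates f m N w R0 s X.
Implicit Types x v : 'rV[R]_5.

(** The coordinate vector of [r] is annihilated by [dphi - w dt], [dpsi - w dt] and [dphi - dpsi],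
    so only the [dt] and [dR] terms contribute to its products. *)
Lemma metric_componentsE x : dom R0 x ->
  let rho := x ord0 i1 in
  let S := sin (x ord0 i2) ^+ 2 in
  let C := cos (x ord0 i2) ^+ 2 in
  let P := N rho / m rho in
  let Q := (m rho ^+ 2 - f rho * N rho) / (m rho * f rho) in
  let k := s * (Num.sqrt rho * Num.sqrt (m rho / N rho)) in
  metric_components (metric f m N w) X x =
  \matrix_(i, j) nth 0 (nth [::]
    [:: [:: - f rho + P * w rho ^+ 2; k; 0;
            - (P * w rho * S); - (P * w rho * C)];
        [:: k; 0; 0; 0; 0];
        [:: 0; 0; m rho / f rho; 0; 0];
        [:: - (P * w rho * S); 0; 0; P * S + Q * S * C; - (Q * S * C)];
        [:: - (P * w rho * C); 0; 0; - (Q * S * C); P * C + Q * S * C]] i) j.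
Proof.
move=> xD rho S C P Q k; have [xR0 _] := xD.
have rho_gt0 : 0 < rho by exact: le_lt_trans xR0.
have [_ eE] := bondi_frameP R0_ge0 X_bondi xD.
have f0 : f rho != 0 by rewrite gt_eqF// f_gt0.
have m0 : m rho != 0 by rewrite gt_eqF// m_gt0.
have N0 : N rho != 0 by rewrite gt_eqF// N_gt0.
(* This relation turns [P * w ^ 2 * (S + C)] in the [(u, u)] entry into [P * w ^ 2]. *)
have SC : S = 1 - C by rewrite /S sin2cos2.
have q2 : Num.sqrt (m rho / N rho) ^+ 2 = m rho / N rho.
  by rewrite sqr_sqrtr// divr_ge0// ltW ?m_gt0 ?N_gt0.
apply/matrixP => i j; rewrite [LHS]mxE !eE /metric -/rho -/S -/C SC.
rewrite [RHS]mxE /P /Q /k.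
move: i j; elim/forall_ord5; elim/forall_ord5; rewrite !mxE/= -/rho.
all: move: q2; set q := Num.sqrt (m rho / N rho); set r := Num.sqrt rho => q2.
all: try by field; rewrite ?f0 ?m0 ?N0.
(* The remaining entry is g_rr: h makes the coordinate vector of r null. *)
transitivity ((m rho / N rho - s ^+ 2 * q ^+ 2) * r ^+ 2 / f rho).
  by field; rewrite ?f0 ?m0 ?N0.
by rewrite s2 q2 mul1r subrr !mul0r.
Qed.

(** The prescribed derivative of [alpha] is the value of the potential on the coordinate vector of
    [r], its angular dependence disappearing by [sin ^ 2 + cos ^ 2 = 1]. As [d alpha] is a multiple
    of [dr], no other component changes. *)
Lemma potential_componentsE (alpha : R -> R) x : dom R0 x ->
  let rho := x ord0 i1 in
  let r := Num.sqrt rho in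
  is_derive r 1 alpha
    (- (s * (Num.sqrt (m rho / N rho) / f rho * r)) *
     (a0 rho + aphi rho * w rho)) ->
  oneform_components (gauge_transform (potential a0 aphi) X alpha) X x =
  \row_i nth 0 [:: a0 rho; 0; 0; aphi rho * sin (x ord0 i2) ^+ 2;
                   aphi rho * cos (x ord0 i2) ^+ 2] i.
Proof.
move=> xD rho r; have [xR0 _] := xD.
have rho_gt0 : 0 < rho by exact: le_lt_trans xR0.
have r0 : r != 0 by rewrite gt_eqF// sqrtr_gt0.
have f0 : f rho != 0 by rewrite gt_eqF// f_gt0.
have [_ eE] := bondi_frameP R0_ge0 X_bondi xD.
set d := - _ * _ => alphad.
have dE v : 'd (fun y => alpha (X y ord0 i1)) x v = d * (('d X x v) ord0 i1).
  have [dX Xr _ _] := X_bondi xD.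
  have : is_derive (X x ord0 i1) 1 alpha d by rewrite Xr.
  move=> /is_diff_comp_coord alphaD.
  have [_ ->] : is_diff x (fun y => alpha (X y ord0 i1)) _ :=
    is_diff_comp (differentiableP dX) alphaD.
  by [].
apply/rowP => i; rewrite [LHS]mxE /gauge_transform eE dE.
have [_ -> _ _ _] :=
  bondi_diffE R0_ge0 X_bondi (row i (bondi_frame f m N w s x)) xD.
rewrite /potential -/rho -/r [RHS]mxE sin2cos2.
move: i; elim/forall_ord5; rewrite !mxE/= -/rho -/r; try ring.
by rewrite /d; field; rewrite r0 f0.
Qed.

(** In the notation [P], [Q], [S], [C] of the components, [S + C = 1] makes the [(phi, psi)] minor
    equal to [P * (P + Q) * S * C], and [P + Q = m / f]. *)
Lemma det_angularE x : dom R0 x ->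
  let rho := x ord0 i1 in
  \det (drsubmx (metric_components (metric f m N w) X x : 'M[R]_(2 + 3, 2 + 3)))
    / (Num.sqrt rho ^+ 6 * sin (x ord0 i2) ^+ 2 * cos (x ord0 i2) ^+ 2)
  = m rho * N rho / (f rho ^+ 2 * rho ^+ 3).
Proof.
move=> xD rho; have [xR0 /andP[x2 x2pi]] := xD.
have rho_gt0 : 0 < rho by exact: le_lt_trans xR0.
have f0 : f rho != 0 by rewrite gt_eqF// f_gt0.
have m0 : m rho != 0 by rewrite gt_eqF// m_gt0.
have N0 : N rho != 0 by rewrite gt_eqF// N_gt0.
have sin0 : sin (x ord0 i2) != 0.
  rewrite gt_eqF// sin_gt0_pi// x2 (lt_trans x2pi)//.
  by rewrite ltr_pdivrMr// ltr_pMr ?pi_gt0// ltr1n.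
have cos0 : cos (x ord0 i2) != 0.
  rewrite gt_eqF// cos_gt0_pihalf// x2pi (lt_trans _ x2)//.
  by rewrite oppr_lt0 divr_gt0 ?pi_gt0.
have -> : Num.sqrt rho ^+ 6 = rho ^+ 3.
  by rewrite (exprM _ 2 3) sqr_sqrtr// ltW.
rewrite metric_componentsE// -/rho.
set A : 'M[R]_5 := \matrix_(i, j) _.
rewrite (expand_det_row _ ord0) !big_ord_recl big_ord0 /cofactor.
rewrite !(expand_det_row _ ord0) !big_ord_recl !big_ord0 /cofactor !det_mx11.
have S0 : 1 - cos (x ord0 i2) ^+ 2 != 0 by rewrite -sin2cos2 expf_neq0.
rewrite !mxE /= /bump /= !expr0 !expr1 !sin2cos2.
by field; rewrite ?f0 ?m0 ?S0 ?cos0 ?gt_eqF.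
Qed.

End Components.

(** * Falloff hypotheses as inequalities in the radius *)

Section Asymptotics.
Context {R : realType}.
Implicit Types f m N w aphi : R -> R.

(* The hypotheses at infinity with a common constant, in terms of r = sqrt R. *)
Definition ansatz_bound f m N w (a0 : R -> R) aphi (C r : R) :=
  [/\ `|f (r ^+ 2) - 1| <= C * r ^- 2, `|m (r ^+ 2) - r ^+ 2| <= C,
      `|N (r ^+ 2) - r ^+ 2 ^+ 2| <= C * r ^+ 2 &
  [/\ `|w (r ^+ 2)| <= C * r ^- 3, `|a0 (r ^+ 2)| <= C * r ^- 2 &
      `|aphi (r ^+ 2)| <= C * r ^- 1]].

Lemma eqO_near_bound (f g : R -> R) : f =O_+oo g ->
  \forall C \near +oo, \forall r \near +oo, `|f (r ^+ 2)| <= C * `|g (r ^+ 2)|.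
Proof.
move=> /eqOP fg; near=> C.
have : \forall x \near +oo, `|f x| <= C * `|g x| by near: C.
move=> [M [_ HM]]; near=> r; apply: HM.
(* For [r >= 1] one has [r <= r ^ 2], so a threshold for [R] also serves as one for [r]. *)
have r1 : 1 <= r by near: r; apply: nbhs_pinfty_ge; exact: num_real.
have Mr : M < r by near: r; apply: nbhs_pinfty_gt; exact: num_real.
by rewrite (lt_le_trans Mr)// expr2 ler_peMr// (le_trans ler01).
Unshelve. all: by end_near. Qed.

Lemma near_ansatz_bound f m N w (a0 : R -> R) aphi :
  (fun x => f x - 1) =O_+oo (fun x => x^-1) ->
  (fun x => m x - x) =O_+oo (fun x => 1 : R) ->
  aphi =O_+oo (fun x => x `^ (- (1 / 2))) ->
  (fun x => N x - x ^+ 2) =O_+oo (fun x => x) ->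
  w =O_+oo (fun x => x `^ (- (3 / 2))) ->
  a0 =O_+oo (fun x => x^-1) ->
  exists C, 1 <= C /\
    \forall r \near +oo, ansatz_bound f m N w a0 aphi C r.
Proof.
move=> /eqO_near_bound fb /eqO_near_bound mb /eqO_near_bound pb.
move=> /eqO_near_bound Nb /eqO_near_bound wb /eqO_near_bound ab.
(* Each estimate holds for all large constants, hence one [C] serves all six. *)
have : \forall C \near +oo, 1 <= C /\
    \forall r \near +oo, ansatz_bound f m N w a0 aphi C r.
  near=> C; split; first by near: C; apply: nbhs_pinfty_ge; exact: num_real.
  near=> r; have r0 : 0 < r by near: r; apply: nbhs_pinfty_gt; exact: num_real.
  have r2 : 0 < r ^+ 2 by rewrite exprn_gt0.
  have powE n : (r ^+ 2) `^ (- (n%:R / 2)) = r ^- n.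
    rewrite powRN -(powR_mulrn _ (ltW r0)) -powRrM mulrC divfK ?pnatr_eq0//.
    by rewrite powR_mulrn// ltW.
  split; last split.
  - rewrite -(gtr0_norm (_ : 0 < r ^- 2)) ?invr_gt0//.
    near: r; near: C; exact: fb.
  - rewrite -[C]mulr1 -(gtr0_norm (@ltr01 R)); near: r; near: C; exact: mb.
  - have -> : C * r ^+ 2 = C * `|r ^+ 2| by rewrite gtr0_norm.
    near: r; near: C; exact: Nb.
  - rewrite -(gtr0_norm (_ : 0 < r ^- 3)) ?invr_gt0 ?exprn_gt0// -powE.
    near: r; near: C; exact: wb.
  - rewrite -(gtr0_norm (_ : 0 < r ^- 2)) ?invr_gt0//.
    near: r; near: C; exact: ab.
  - rewrite -(gtr0_norm (_ : 0 < r ^- 1)) ?invr_gt0 ?exprn_gt0// -powE.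
    near: r; near: C; exact: pb.
by move=> /pinfty_ex_gt0[C _ [C1 HC]]; exists C.
Unshelve. all: by end_near. Qed.

End Asymptotics.

(** The entry bounds below write an error as a single fraction, then bound its numerator above and
    its denominator below; their constants arise as such quotients. *)
Lemma ler_norm_div (R : numFieldType) (a b A B : R) :
  `|a| <= A -> 0 < B -> B <= b -> `|a / b| <= A / B.
Proof.
move=> aA B0 Bb; have b0 := lt_le_trans B0 Bb.
rewrite normrM normfV (gtr0_norm b0) ler_pM ?invr_ge0 ?(ltW b0)//.
by rewrite lef_pV2 ?posrE.
Qed.

(** Factor [q - 1] as [(sqrt q - 1) * (sqrt q + 1)]; the second factor is at least 1. *)
Lemma ler_norm_sqrtB1 (R : rcfType) (q : R) : 0 <= q ->
  `|Num.sqrt q - 1| <= `|q - 1|.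
Proof.
move=> q0; rewrite -[q in leRHS]sqr_sqrtr// -[1 in leRHS](expr1n _ 2) subr_sqr.
rewrite normrM ler_peMr// ger0_norm; rewrite ?lerDr ?addr_ge0 ?sqrtr_ge0//.
Qed.

(** * Estimates at a fixed [x = r ^ 2], with [F], [M], [n] the values of [f], [m], [N] *)

Section EntryBounds.
Context {R : realType}.
Variables (C x F M n : R).
Hypotheses (C1 : 1 <= C) (Cx : 2 * C <= x).
Hypotheses (bF : `|F - 1| <= C / x) (bM : `|M - x| <= C).
Hypothesis bn : `|n - x ^+ 2| <= C * x.

Let x_gt0 : 0 < x. Proof. have := C1; have := Cx; lra. Qed.

(** By [2 * C <= x] the relative errors of [F], [M] and [n] are at most one half. *)
Lemma f_bounds : 2^-1 <= F <= 2.
Proof.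
have : C / x <= 2^-1 by have := Cx; rewrite ler_pdivrMr//; lra.
by move: bF; rewrite ler_norml => /andP[? ?] ?; apply/andP; split; lra.
Qed.

Lemma m_bounds : x / 2 <= M <= 2 * x.
Proof.
move: bM x_gt0 Cx; rewrite ler_norml => /andP[? ?] ? ?.
by apply/andP; split; lra. Qed.

Lemma n_bounds : x ^+ 2 / 2 <= n <= 2 * x ^+ 2.
Proof.
have : C * x <= x ^+ 2 / 2 by have := Cx; rewrite expr2 mulrAC ler_pM2r//; lra.
move: bn (sqr_ge0 x); rewrite ler_norml => /andP[? ?] ? ?.
by apply/andP; split; lra.
Qed.

Let F_gt0 : 0 < F. Proof. by have /andP[? _] := f_bounds; lra. Qed.
Let M_gt0 : 0 < M. Proof. by have /andP[] := m_bounds; have := x_gt0; lra. Qed.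
Let n_gt0 : 0 < n.
Proof. by have /andP[] := n_bounds; have := exprn_gt0 2 x_gt0; lra. Qed.
Let x0 : x != 0. Proof. exact: lt0r_neq0. Qed.
Let F0 : F != 0. Proof. exact: lt0r_neq0. Qed.
Let M0 : M != 0. Proof. exact: lt0r_neq0. Qed.
Let n0 : n != 0. Proof. exact: lt0r_neq0. Qed.

Let bxF : `|x * (F - 1)| <= C.
Proof. by rewrite normrM gtr0_norm// mulrC -ler_pdivlMr. Qed.

Let bxM : `|x * (M - x)| <= C * x.
Proof. by rewrite normrM gtr0_norm// mulrC ler_pM2r. Qed.

Lemma m_div_f_bound : `|M / F - x| <= 4 * C.
Proof.
have -> : M / F - x = ((M - x) - x * (F - 1)) / F by field.
have -> : 4 * C = (C + C) / 2^-1 by field.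
apply: ler_norm_div; [|by []|by have /andP[] := f_bounds].
by rewrite (le_trans (ler_normB _ _))// lerD.
Qed.

Lemma n_div_m_bound : `|n / M - x| <= 4 * C.
Proof.
have -> : n / M - x = ((n - x ^+ 2) - x * (M - x)) / M by field.
have -> : 4 * C = (C * x + C * x) / (x / 2) by field.
apply: ler_norm_div; [|by rewrite divr_gt0|by have /andP[] := m_bounds].
by rewrite (le_trans (ler_normB _ _))// lerD.
Qed.

Lemma n_div_m_le : `|n / M| <= 4 * x.
Proof.
have -> : 4 * x = (2 * x ^+ 2) / (x / 2) by field.
apply: ler_norm_div; [|by rewrite divr_gt0|by have /andP[] := m_bounds].
by rewrite gtr0_norm//; have /andP[] := n_bounds.
Qed.

(** The leading terms [x ^ 2] of [M ^ 2] and [F * n] cancel. What remains is of order [x], like the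
    denominator: at most [6 * C * x] over at least [x / 4]. *)
Lemma anisotropy_bound : `|(M ^+ 2 - F * n) / (M * F)| <= 24 * C.
Proof.
have -> : M ^+ 2 - F * n =
    (M - x) * (M + x) - x * (F - 1) * (n / x) - (n - x ^+ 2) by field.
have -> : 24 * C = (C * (3 * x) + C * (2 * x) + C * x) / (x / 2 * 2^-1).
  by field.
have /andP[F1 F2] := f_bounds; have /andP[M1 M2] := m_bounds.
have /andP[n1 n2] := n_bounds.
have x_gt := x_gt0; have C_gt := C1.
apply: ler_norm_div; [|lra|by apply: ler_pM => //; lra].
rewrite (le_trans (ler_normB _ _))// lerD// (le_trans (ler_normB _ _))// lerD//.
  by rewrite normrM ler_pM// gtr0_norm; lra.
rewrite normrM ler_pM// gtr0_norm ?divr_gt0// ler_pdivrMr//.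
by rewrite -mulrA -expr2.
Qed.

Lemma g_ur_bound : `|Num.sqrt x * Num.sqrt (M / n) - 1| <= 4 * C / x.
Proof.
have q_ge0 : 0 <= x * (M / n) by rewrite !mulr_ge0 ?invr_ge0 ?ltW.
rewrite -sqrtrM ?(ltW x_gt0)//.
apply: (le_trans (ler_norm_sqrtB1 q_ge0)).
have -> : x * (M / n) - 1 = (x * (M - x) - (n - x ^+ 2)) / n by field.
have -> : 4 * C / x = (C * x + C * x) / (x ^+ 2 / 2) by field.
apply: ler_norm_div;
  [|by rewrite divr_gt0 ?exprn_gt0|by have /andP[] := n_bounds].
by rewrite (le_trans (ler_normB _ _))// lerD.
Qed.

Lemma det_ratio_bound : `|M * n / (F ^+ 2 * x ^+ 3) - 1| <= 24 * C / x.
Proof.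
(* Telescoping, so that each term contains exactly one of the three small errors of [M], [n] and
   [F]. *)
have -> : M * n / (F ^+ 2 * x ^+ 3) - 1 =
  ((M - x) * n + x * (n - x ^+ 2) - x * (F - 1) * ((F + 1) * x ^+ 2))
    / (F ^+ 2 * x ^+ 3) by field; rewrite F0 x0.
have -> : 24 * C / x =
    (C * (2 * x ^+ 2) + x * (C * x) + C * (3 * x ^+ 2)) / (2^-1 ^+ 2 * x ^+ 3).
  by field.
have /andP[F1 F2] := f_bounds; have /andP[M1 M2] := m_bounds.
have /andP[n1 n2] := n_bounds; have x3 := exprn_gt0 3 x_gt0.
have x2 := exprn_gt0 2 x_gt0.
apply: ler_norm_div; last 2 first.
- by rewrite mulr_gt0.
- by rewrite ler_pM2r// lerXn2r// nnegrE ?ltW.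
rewrite (le_trans (ler_normB _ _))// lerD//
  ?(le_trans (ler_normD _ _))// ?lerD//.
- by rewrite normrM ler_pM// gtr0_norm.
- by rewrite normrM gtr0_norm// ler_pM2l.
- rewrite normrM ler_pM// normrM (gtr0_norm x2) ler_pM2r// gtr0_norm; lra.
Qed.

End EntryBounds.

(** * Orders of all components and the determinant condition *)

Section BondiForm.
Context {R : realType}.
Variables (f m N w a0 aphi : R -> R) (R0 s C K : R).
Hypothesis R0_ge0 : 0 <= R0.
Hypothesis f_gt0 : forall rho, R0 < rho -> 0 < f rho.
Hypothesis m_gt0 : forall rho, R0 < rho -> 0 < m rho.
Hypothesis N_gt0 : forall rho, R0 < rho -> 0 < N rho.
Hypothesis hs : s = 1 \/ s = -1.
Hypothesis C1 : 1 <= C.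
Hypothesis K_ge : 2 * C <= K.
Hypothesis bound : forall r, K < r -> ansatz_bound f m N w a0 aphi C r.
Variable X : 'rV[R]_5 -> 'rV[R]_5.
Hypothesis X_bondi : bondi_coordinates f m N w R0 s X.
Implicit Types x v : 'rV[R]_5.

Let s2 : s ^+ 2 = 1. Proof. by case: hs => ->; rewrite ?sqrrN expr1n. Qed.
Let C_ge0 : 0 <= C. Proof. exact: le_trans C1. Qed.

Lemma has_order_sqrt n C' (F : 'rV[R]_5 -> R) :
  (forall x, dom R0 x -> K < Num.sqrt (x ord0 i1) ->
    `|F x| <= C' * Num.sqrt (x ord0 i1) ^- n) ->
  has_order (dom R0) (fun x => X x ord0 i1) (Some n) F.
Proof.
by move=> FC; exists C', K => x xD; have [_ -> _ _] := X_bondi xD; exact: FC.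
Qed.

Lemma sin2_cos2_le1 (t : R) : [/\ `|sin t ^+ 2| <= 1, `|cos t ^+ 2| <= 1 &
  `|sin t ^+ 2 * cos t ^+ 2| <= 1].
Proof.
have H (y : R) : -1 <= y <= 1 -> `|y ^+ 2| <= 1.
  by move=> y1; rewrite normrX exprn_ile1// ler_norml.
have S1 : `|sin t ^+ 2| <= 1 by apply: H; rewrite sin_geN1 sin_le1.
have Co1 : `|cos t ^+ 2| <= 1 by apply: H; rewrite cos_geN1 cos_le1.
by split=> //; rewrite normrM mulr_ile1.
Qed.

Lemma far_radius x : dom R0 x -> K < Num.sqrt (x ord0 i1) ->
  exists2 r, K < r & [/\ 1 < r, x ord0 i1 = r ^+ 2 & Num.sqrt (x ord0 i1) = r].
Proof.
move=> [xR0 _] Kr; exists (Num.sqrt (x ord0 i1)) => //; split=> //.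
  by have := C1; have := K_ge; lra.
by rewrite sqr_sqrtr// ltW// (le_lt_trans R0_ge0).
Qed.

Lemma far_sqr r : K < r -> 1 < r -> 2 * C <= r ^+ 2.
Proof.
move=> Kr r1; rewrite (le_trans K_ge)// (le_trans (ltW Kr))// expr2 ler_peMr//.
  by rewrite ltW// (lt_trans ltr01).
exact: ltW.
Qed.

Lemma rotation_bound r : K < r -> 1 < r ->
  `|N (r ^+ 2) / m (r ^+ 2) * w (r ^+ 2)| <= 4 * C * r ^- 1.
Proof.
move=> Kr r1; have [_ bm bN [bw _ _]] := bound Kr.
have r0 : r != 0 by rewrite gt_eqF// (lt_trans ltr01).
have -> : 4 * C * r ^- 1 = 4 * r ^+ 2 * (C * r ^- 3) by field.
rewrite normrM ler_pM//; exact: n_div_m_le (far_sqr Kr r1) bm bN.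
Qed.

Lemma g_uu_bound r : K < r -> 1 < r ->
  `|- f (r ^+ 2) + N (r ^+ 2) / m (r ^+ 2) * w (r ^+ 2) ^+ 2 - -1|
  <= (C + 4 * C ^+ 2) * r ^- 2.
Proof.
move=> Kr r1; have [bf _ _ [bw _ _]] := bound Kr.
have r0 : 0 < r by rewrite (lt_trans ltr01).
have -> : - f (r ^+ 2) + N (r ^+ 2) / m (r ^+ 2) * w (r ^+ 2) ^+ 2 - -1 =
  N (r ^+ 2) / m (r ^+ 2) * w (r ^+ 2) * w (r ^+ 2) - (f (r ^+ 2) - 1) by ring.
rewrite mulrDl [leRHS]addrC (le_trans (ler_normB _ _))// lerD// normrM.
(* The rotation term is of order [r ^ -4]; since [r > 1] it is absorbed into [r ^ -2]. *)
apply: (@le_trans _ _ (4 * C * r ^- 1 * (C * r ^- 3))).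
  by rewrite ler_pM// rotation_bound.
have -> : 4 * C * r ^- 1 * (C * r ^- 3) = 4 * C ^+ 2 * r ^- 2 * r ^- 2.
  by field; rewrite gt_eqF.
rewrite ler_piMr// ?mulr_ge0 ?invr_ge0 ?exprn_ge0 ?(ltW r0)//.
by rewrite invf_le1 ?exprn_gt0// exprn_ege1// ltW.
Qed.

Lemma metric_has_order i j :
  has_order (dom R0) (fun x => X x ord0 i1) (metric_order i j)
    (fun x => metric_components (metric f m N w) X x i j
              - flat_metric s (X x ord0 i1) (X x ord0 i2) i j).
Proof.
move: i j; have GE := metric_componentsE R0_ge0 f_gt0 m_gt0 N_gt0 s2 X_bondi.
have ns a : `|s * a| = `|a|.
  by rewrite normrM; case: hs => ->; rewrite ?normrN normr1 mul1r.
have entry n C' i j : (forall x r, dom R0 x -> K < r -> 1 < r ->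
      x ord0 i1 = r ^+ 2 -> Num.sqrt (r ^+ 2) = r ->
      `|metric_components (metric f m N w) X x i j
        - flat_metric s r (x ord0 i2) i j| <= C' * r ^- n) ->
    has_order (dom R0) (fun x => X x ord0 i1) (Some n)
      (fun x => metric_components (metric f m N w) X x i j
                - flat_metric s (X x ord0 i1) (X x ord0 i2) i j).
  move=> FC; apply: (has_order_sqrt (C' := C')) => x xD.
  move=> /(far_radius xD)[r Kr [r1 xE rE]]; have [_ -> -> _] := X_bondi xD.
  by rewrite rE; apply: FC => //; rewrite -xE.
have shift_le r t : K < r -> 1 < r -> `|t| <= 1 ->
    `|- (N (r ^+ 2) / m (r ^+ 2) * w (r ^+ 2) * t) - 0| <= 4 * C * r ^- 1.
  move=> Kr r1 t1; rewrite subr0 normrN normrM.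
  by rewrite (le_trans (ler_piMr _ t1))// rotation_bound.
have aniso_le r t : K < r -> 1 < r ->
    `|(m (r ^+ 2) ^+ 2 - f (r ^+ 2) * N (r ^+ 2)) / (m (r ^+ 2) * f (r ^+ 2))
      * sin t ^+ 2 * cos t ^+ 2| <= 24 * C.
  move=> Kr r1; have [_ _ sc] := sin2_cos2_le1 t; have [bf bm bN _] := bound Kr.
  rewrite -mulrA normrM (le_trans (ler_piMr _ sc))//.
  exact: anisotropy_bound (far_sqr Kr r1) bf bm bN.
have angle_le r t a : K < r -> 1 < r -> `|a| <= 1 ->
    `|N (r ^+ 2) / m (r ^+ 2) * a +
      (m (r ^+ 2) ^+ 2 - f (r ^+ 2) * N (r ^+ 2)) / (m (r ^+ 2) * f (r ^+ 2))
      * sin t ^+ 2 * cos t ^+ 2 - r ^+ 2 * a| <= 4 * C + 24 * C.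
  move=> Kr r1 a1; have [_ bm bN _] := bound Kr.
  rewrite addrAC -mulrBl (le_trans (ler_normD _ _))// lerD//;
    last exact: aniso_le.
  rewrite normrM (le_trans (ler_piMr _ a1))//.
  exact: n_div_m_bound (far_sqr Kr r1) bm bN.
have g_ur r : K < r -> 1 < r -> Num.sqrt (r ^+ 2) = r ->
    `|s * (r * Num.sqrt (m (r ^+ 2) / N (r ^+ 2))) - s| <= 4 * C * r ^- 2.
  move=> Kr r1 rE; rewrite -[X in _ - X]mulr1 -mulrBr ns.
  rewrite -[X in X * Num.sqrt _]rE.
  by have [bf bm bN _] := bound Kr; exact: g_ur_bound (far_sqr Kr r1) bm bN.
have exact0 n i j : (forall x, dom R0 x ->
      metric_components (metric f m N w) X x i j
      - flat_metric s (X x ord0 i1) (X x ord0 i2) i j = 0) ->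
    has_order (dom R0) (fun x => X x ord0 i1) (Some n)
      (fun x => metric_components (metric f m N w) X x i j
                - flat_metric s (X x ord0 i1) (X x ord0 i2) i j).
  move=> F0; apply: (has_order_sqrt (C' := 0)) => x xD _.
  by rewrite F0// normr0 mul0r.
elim/forall_ord5; elim/forall_ord5; rewrite [metric_order _ _]/=.
(* The first pass settles the entries required to vanish identically, the second those that are
   allowed an order but have zero correction, namely the products of [theta] with [u], [phi] and
   [psi]. *)
all: try by move=> x xD; rewrite GE// !mxE/= subrr.
all: try by apply: exact0 => x xD; rewrite GE// !mxE/= subrr.
(* Twelve entries remain, row by row: [uu], [ur], [u phi], [u psi]; [ru]; [theta theta]; [phi u],
   [phi phi], [phi psi]; [psi u], [psi phi], [psi psi]. *)
- apply: entry => x r xD Kr r1 xE rE; rewrite GE// !mxE/= xE.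
  exact: g_uu_bound.
- by apply: entry => x r xD Kr r1 xE rE; rewrite GE// !mxE/= xE rE; exact: g_ur.
- apply: entry => x r xD Kr r1 xE rE; rewrite GE// !mxE/= xE.
  by apply: shift_le => //; have [] := sin2_cos2_le1 (x ord0 i2).
- apply: entry => x r xD Kr r1 xE rE; rewrite GE// !mxE/= xE.
  by apply: shift_le => //; have [] := sin2_cos2_le1 (x ord0 i2).
- by apply: entry => x r xD Kr r1 xE rE; rewrite GE// !mxE/= xE rE; exact: g_ur.
- apply: entry => x r xD Kr r1 xE rE; rewrite GE// !mxE/= xE expr0 invr1 mulr1.
  by have [bf bm bN _] := bound Kr; exact: m_div_f_bound (far_sqr Kr r1) bf bm.
- apply: entry => x r xD Kr r1 xE rE; rewrite GE// !mxE/= xE.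
  by apply: shift_le => //; have [] := sin2_cos2_le1 (x ord0 i2).
- apply: entry => x r xD Kr r1 xE rE; rewrite GE// !mxE/= xE expr0 invr1 mulr1.
  by apply: angle_le => //; have [] := sin2_cos2_le1 (x ord0 i2).
- apply: entry => x r xD Kr r1 xE rE; rewrite GE// !mxE/= xE expr0 invr1 mulr1.
  by rewrite subr0 normrN; exact: aniso_le.
- apply: entry => x r xD Kr r1 xE rE; rewrite GE// !mxE/= xE.
  by apply: shift_le => //; have [] := sin2_cos2_le1 (x ord0 i2).
- apply: entry => x r xD Kr r1 xE rE; rewrite GE// !mxE/= xE expr0 invr1 mulr1.
  by rewrite subr0 normrN; exact: aniso_le.
- apply: entry => x r xD Kr r1 xE rE; rewrite GE// !mxE/= xE expr0 invr1 mulr1.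
  by apply: angle_le => //; have [] := sin2_cos2_le1 (x ord0 i2).
Qed.

Lemma bondi_form_of_gauge (alpha : R -> R) :
  (forall r, Num.sqrt R0 < r -> is_derive r 1 alpha
    (- (s * (Num.sqrt (m (r ^+ 2) / N (r ^+ 2)) / f (r ^+ 2) * r)) *
     (a0 (r ^+ 2) + aphi (r ^+ 2) * w (r ^+ 2)))) ->
  bondi_form (dom R0) X s (metric_components (metric f m N w) X)
    (oneform_components (gauge_transform (potential a0 aphi) X alpha) X).
Proof.
move=> alphaD; split; first exact: metric_has_order.
- have alphax x : dom R0 x -> let rho := x ord0 i1 in
      is_derive (Num.sqrt rho) 1 alpha
        (- (s * (Num.sqrt (m rho / N rho) / f rho * Num.sqrt rho)) *
         (a0 rho + aphi rho * w rho)).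
    move=> [xR0 _] rho; have rho_gt0 : 0 < rho by exact: le_lt_trans xR0.
    have := alphaD (Num.sqrt rho); rewrite sqr_sqrtr ?(ltW rho_gt0)//; apply.
    by rewrite ltr_sqrt.
  have AE x (xD : dom R0 x) :=
    potential_componentsE R0_ge0 f_gt0 X_bondi xD (alphax x xD).
  elim/forall_ord5; rewrite [potential_order _]/=.
  + apply: (has_order_sqrt (C' := C)) => x xD /(far_radius xD)[r Kr [r1 xE rE]].
    rewrite AE// mxE/= rE xE.
    by have [_ _ _ []] := bound Kr.
  + by move=> x xD; rewrite AE// mxE.
  + apply: (has_order_sqrt (C' := 0)) => x xD _.
    by rewrite AE// mxE/= normr0 mul0r.
  + apply: (has_order_sqrt (C' := C)) => x xD /(far_radius xD)[r Kr [r1 xE rE]].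
    rewrite AE// mxE/= rE xE normrM.
    have [_ _ _ [_ _ ba]] := bound Kr.
    have [sin1 cos1 _] := sin2_cos2_le1 (x ord0 i2).
    by rewrite (le_trans (ler_piMr _ sin1)).
  + apply: (has_order_sqrt (C' := C)) => x xD /(far_radius xD)[r Kr [r1 xE rE]].
    rewrite AE// mxE/= rE xE normrM.
    have [_ _ _ [_ _ ba]] := bound Kr.
    have [sin1 cos1 _] := sin2_cos2_le1 (x ord0 i2).
    by rewrite (le_trans (ler_piMr _ cos1)).
(* The ratio differs from 1 by at most [24 * C / r ^ 2], and [r ^ 2 >= r > 24 * C / e]. *)
- move=> e e0; exists (Num.max K (24 * C / e)) => x xD.
  have [_ -> -> _] := X_bondi xD; rewrite gt_max => /andP[Kr er].
  rewrite (det_angularE R0_ge0 f_gt0 m_gt0 N_gt0 s2 X_bondi xD).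
  have [r {}Kr [r1 xE rE]] := far_radius xD Kr; move: er; rewrite rE xE => er.
  have r0 : 0 < r by rewrite (lt_trans ltr01).
  have [bf bm bN _] := bound Kr.
  apply: le_lt_trans (det_ratio_bound C1 (far_sqr Kr r1) bf bm bN) _.
  rewrite ltr_pdivrMr ?exprn_gt0// [ltRHS]mulrC -ltr_pdivrMr//.
  rewrite (lt_le_trans er)//.
  by rewrite expr2 ler_peMr// ltW.
Qed.

End BondiForm.

(** * Existence of the coordinates, chart property and choice of gauge *)

Theorem mainTheorem2 (R : realType) (R0 : R) (f m N w a0 aphi : R -> R)
  (hR0 : 0 <= R0)
  (fC : smooth_above R0 f) (mC : smooth_above R0 m) (NC : smooth_above R0 N)
  (wC : smooth_above R0 w) (a0C : smooth_above R0 a0)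
  (aphiC : smooth_above R0 aphi)
  (f_gt0 : forall x, R0 < x -> 0 < f x)
  (m_gt0 : forall x, R0 < x -> 0 < m x)
  (N_gt0 : forall x, R0 < x -> 0 < N x)
  (f_oo : (fun x => f x - 1) =O_+oo (fun x => x^-1))
  (m_oo : (fun x => m x - x) =O_+oo (fun x => 1 : R))
  (aphi_oo : aphi =O_+oo (fun x => x `^ (- (1 / 2))))
  (N_oo : (fun x => N x - x ^+ 2) =O_+oo (fun x => x))
  (w_oo : w =O_+oo (fun x => x `^ (- (3 / 2))))
  (a0_oo : a0 =O_+oo (fun x => x^-1))
  (s : R) (hs : s = 1 \/ s = -1) :
  (exists X : 'rV[R]_5 -> 'rV[R]_5, bondi_coordinates f m N w R0 s X) /\
  forall X : 'rV[R]_5 -> 'rV[R]_5, bondi_coordinates f m N w R0 s X ->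
    is_chart (dom R0) X /\
    exists alpha : R -> R,
      smooth_above (Num.sqrt R0) alpha /\
      bondi_form (dom R0) X s
        (metric_components (metric f m N w) X)
        (oneform_components
           (gauge_transform (potential a0 aphi) X alpha) X).
Proof.
have {}fC := (smooth_aboveP _ _).1 fC; have {}mC := (smooth_aboveP _ _).1 mC.
have {}NC := (smooth_aboveP _ _).1 NC; have {}wC := (smooth_aboveP _ _).1 wC.
have {}a0C := (smooth_aboveP _ _).1 a0C.
have {}aphiC := (smooth_aboveP _ _).1 aphiC.
have sqC n : diff_above n R0 (fun rho => Num.sqrt (m rho / N rho)).
  apply: diff_above_sqrt => [x xR0|]; first by rewrite divr_gt0 ?m_gt0 ?N_gt0.
  by apply/diff_aboveM/diff_aboveV => // x /N_gt0/gt_eqF->.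
have fVC n : diff_above n R0 (fun rho => (f rho)^-1).
  by apply: diff_aboveV => // x /f_gt0/gt_eqF->.
have hC n : diff_above n R0 (fun rho => Num.sqrt (m rho / N rho) / (2 * f rho)).
  apply/diff_aboveM/diff_aboveV => //; last exact: diff_aboveZ.
  by move=> x /f_gt0 fx; rewrite mulf_neq0 ?pnatr_eq0// gt_eqF.
split.
  (* Primitives of [h] and [w * h] on the whole ray integrate the prescribed differentials. *)
  have [H HD] : exists H : R -> R, forall x, R0 < x -> is_derive x 1 H _ :=
    primitive_above (fun x => diff_above_continuous (hC 1%N)).
  have [W WD] : exists W : R -> R, forall x, R0 < x -> is_derive x 1 W _ :=
    primitive_above
      (fun x => diff_above_continuous (diff_aboveM (wC 1%N) (hC 1%N))).
  by exists (bondi_map s H W); exact: bondi_map_coordinates.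
move=> X X_bondi; split.
  split; first exact: bondi_injective X_bondi.
  by move=> x xD; have [] := bondi_frameP hR0 X_bondi xD;
    have [] := X_bondi x xD.
have [C [C1]] := near_ansatz_bound f_oo m_oo aphi_oo N_oo w_oo a0_oo.
move=> [M [_ HM]].
(* [G] is the [r]-component of the potential before the gauge transformation; [alpha] will be a
   primitive of it. *)
pose G r := - (s * (Num.sqrt (m (r ^+ 2) / N (r ^+ 2)) / f (r ^+ 2) * r)) *
     (a0 (r ^+ 2) + aphi (r ^+ 2) * w (r ^+ 2)).
have GC n : diff_above n (Num.sqrt R0) G.
  have comp F : diff_above n R0 F ->
      diff_above n (Num.sqrt R0) (fun r => F (r ^+ 2)).
    move=> FC; apply: diff_above_comp FC _.
      move=> r R0r; have r0 := le_lt_trans (sqrtr_ge0 R0) R0r.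
      by rewrite -[ltLHS]sqr_sqrtr// ltr_pXn2r// nnegrE ?sqrtr_ge0 ?(ltW r0).
    under eq_fun do rewrite expr2.
    exact/diff_aboveM/diff_above_id/diff_above_id.
  apply: diff_aboveM; last exact: diff_aboveD
    (comp _ (a0C n)) (comp _ (diff_aboveM (aphiC n) (wC n))).
  under eq_fun do rewrite -mulNr.
  apply/diff_aboveZ/diff_aboveM/diff_above_id.
  exact: comp (diff_aboveM (sqC n) (fVC n)).
have [alpha alphaD] :=
  primitive_above (fun r => diff_above_continuous (GC 1%N)).
exists alpha; split.
  apply/smooth_aboveP => -[//|n]; exact: diff_above_derive alphaD (GC n).
(* Beyond [M] the falloff inequalities hold with the constant [C]; the bound [2 * C] provides the
   smallness used in the entry estimates. *)
apply: (@bondi_form_of_gauge _ _ _ _ _ _ _ _ _ C (Num.max M (2 * C))) => //.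
  by rewrite le_max lexx orbT.
by move=> r; rewrite gt_max => /andP[/HM].
Qed.
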